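(* Let $S$ be a finite set with $|S|\ge2$, let $(\mathcal{F}_n)_{n\ge0}$ be families of finite subsets of $\overline{S}=S^{\mathbb{N}}$ as described in the context, let $Y$ be a reflexive Banach space with a normalized $1$-unconditional basis $(e_j)_{j=0}^\infty$, and let $X$ be the associated space described in the context. If $(\mathcal{F}_n)$ satisfies the inclusion condition, then $X$ is reflexive.
   Context: Families of sets. Let $\overline{S}=S^{\mathbb{N}}$. For distinct $p=(p(i))_{i\ge1}$, $q=(q(i))_{i\ge1}$ in $\overline{S}$ let $d(p,q)=\min\{k\ge 1: p(k)\ne q(k)\}$. For $A\subset\overline{S}$ with $|A|\ge2$ let $A^\sharp=\min\{d(p,q):p,q\in A,\ p\ne q\}$. Let $\mathcal{F}_0=\{\emptyset\}\cup\{\{p\}:p\in\overline{S}\}$. For $n\ge1$, $\mathcal{F}_n$ is any hereditary family (closed under taking subsets) of finite subsets of $\overline{S}$ such that $\mathcal{F}_{n-1}\subseteq\mathcal{F}_n$ and every $A\in\mathcal{F}_n$ with $|A|\ge2$ can be written $A=\bigcup_{i=1}^{A^\sharp}A_i$ with $A_i\in\mathcal{F}_{n-1}$ for $1\le i\le A^\sharp$. Inclusion condition (for $S$ finite). (a) For each $n\ge1$ and $M\in\mathbb{N}$: whenever $(A_i)_{i=1}^\infty$ is a sequence of disjoint sets with $A_i\in\mathcal{F}_n$, $|A_i|\ge2$ (so that $A_i^\sharp$ is defined) and $A_i^\sharp\to\infty$, there exist $i_1<\dots<i_M$ with $\bigcup_{k=1}^MA_{i_k}\in\mathcal{F}_{n+1}$.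 (b) For every sequence $(\gamma_i)\subseteq\overline{S}$ and every $M\in\mathbb{N}$ there exist $i_1<\dots<i_M$ with $\{\gamma_{i_k}:1\le k\le M\}\in\mathcal{F}_1$. The space $X$. $c_{00}(\overline{S})$ is the space of finitely supported scalar functions on $\overline{S}$. For $j\ge0$ let $\|x\|_j=\sup_{F\in\mathcal{F}_j}\sum_{\gamma\in F}|x_\gamma|$. $X$ is the completion of $c_{00}(\overline{S})$ under $\|x\|=\big\|\sum_{j=0}^\infty2^{-j}\|x\|_je_j\big\|_Y$. A basis $(e_j)$ is $1$-unconditional if $\|\sum\pm a_je_j\|\le\|\sum a_je_j\|$ for all scalars and all choices of signs. *)

(* Defs.v *)
From HB Require Import structures.
From mathcomp Require Import all_boot all_order all_algebra finmap.
From mathcomp Require Import all_classical all_reals all_analysis.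

Set Implicit Arguments.
Unset Strict Implicit.
Unset Printing Implicit Defensive.

Import Order.TTheory GRing.Theory Num.Theory.
Import numFieldNormedType.Exports.

Local Open Scope classical_set_scope.
Local Open Scope ring_scope.

(** * Topological dual and reflexivity of real normed spaces *)

Section Dual.
Variables (R : realType) (X : normedModType R).

Definition functional_pred : {pred X -> R^o} :=
  mem [set f : X -> R^o | scalar f /\ continuous f].

Fact functional_submod_closed : submod_closed functional_pred.
Proof.
split; first by rewrite inE; split => [a x y|x]; [rewrite mulr0 addr0|exact: cvg_cst].
move=> a f g; rewrite !inE => -[lf cf] [lg cg]; split => [b x y|x].
  rewrite !fctE lf lg !scalerDr /GRing.scale /= mulrDr !mulrA.
  by rewrite (mulrC a b) -!addrA; congr (_ + _); rewrite addrCA.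
by apply: cvgD; [apply: cvgZl_tmp; exact: cf|exact: cg].
Qed.

HB.instance Definition _ := GRing.isSubmodClosed.Build R (X -> R^o)
  functional_pred functional_submod_closed.

Record dual :=
  Dual { functional :> X -> R^o; _ : functional \in functional_pred }.

HB.instance Definition _ := [isSub for functional].
HB.instance Definition _ := [Choice of dual by <:].
HB.instance Definition _ := [SubChoice_isSubLmodule of dual by <:].

Lemma dual_linear (f : dual) : scalar f.
Proof. by have := valP f; rewrite inE => -[]. Qed.

Lemma dual_continuous (f : dual) : continuous f.
Proof. by have := valP f; rewrite inE => -[]. Qed.

HB.instance Definition _ (f : dual) :=
  GRing.isLinear.Build R X R^o *:%R f (@dual_linear f).

Definition dual_values (f : dual) : set R :=
  [set `|f x| | x in [set x : X | `|x| <= 1]].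

Definition dual_norm (f : dual) : R := sup (dual_values f).

Lemma dual_bounded (f : dual) : exists2 M, 0 < M & forall x, `|f x| <= M * `|x|.
Proof.
have /linear_bounded_continuous/linear_boundedP/pinfty_ex_gt0[M M0 fM] :=
  @dual_continuous f.
by exists M.
Qed.

Lemma dual_values_has_sup (f : dual) : has_sup (dual_values f).
Proof.
split; first by exists `|f 0|; exists 0 => //=; rewrite normr0.
have [M M0 fM] := dual_bounded f; exists M => _ [x /= x1 <-].
by rewrite (le_trans (fM x))// ler_piMr// ltW.
Qed.

Lemma dual_norm_ub (f : dual) x : `|x| <= 1 -> `|f x| <= dual_norm f.
Proof.
by move=> x1; apply: (sup_upper_bound (dual_values_has_sup f)); exists x.
Qed.

Lemma dual_norm_le (f : dual) M :
  (forall x, `|x| <= 1 -> `|f x| <= M) -> dual_norm f <= M.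
Proof.
move=> fM; apply: ge_sup; first by case: (dual_values_has_sup f).
by move=> _ [x /= x1 <-]; exact: fM.
Qed.

Lemma dual_norm_ge0 (f : dual) : 0 <= dual_norm f.
Proof. by apply: le_trans (@dual_norm_ub f 0 _) => //; rewrite normr0. Qed.

Lemma ler_dual_normD (f g : dual) :
  dual_norm (f + g) <= dual_norm f + dual_norm g.
Proof.
apply: dual_norm_le => x x1; apply: le_trans (ler_normD (f x) (g x)) _.
by rewrite lerD// dual_norm_ub.
Qed.

Lemma ler_dual_normZ a (f : dual) : dual_norm (a *: f) <= `|a| * dual_norm f.
Proof.
apply: dual_norm_le => x x1.
have -> : (a *: f) x = a * f x by [].
by rewrite normrM ler_wpM2l// dual_norm_ub.
Qed.

Lemma dual_normZ a (f : dual) : dual_norm (a *: f) = `|a| * dual_norm f.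
Proof.
apply/eqP; rewrite eq_le ler_dual_normZ/=.
have [->|a0] := eqVneq a 0; first by rewrite normr0 mul0r dual_norm_ge0.
rewrite -ler_pdivlMl ?normr_gt0// -normfV.
by apply: le_trans (ler_dual_normZ _ _); rewrite scalerA mulVf// scale1r.
Qed.

Lemma dual_norm_apply (f : dual) x : `|f x| <= dual_norm f * `|x|.
Proof.
have [->|x0] := eqVneq x 0; first by rewrite linear0 !normr0 mulr0.
rewrite -ler_pdivrMr ?normr_gt0//.
have : `|f (`|x|^-1 *: x)| <= dual_norm f.
  by apply: dual_norm_ub; rewrite normrZ normfV normr_id mulVf ?normr_eq0.
by rewrite linearZ /= normrZ normfV normr_id mulrC.
Qed.

Lemma dual_norm0_eq0 (f : dual) : dual_norm f = 0 -> f = 0.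
Proof.
move=> f0; apply/val_inj/funext => x /=.
by apply/normr0_eq0/le_anti; rewrite normr_ge0 (le_trans (dual_norm_apply f x))// f0 mul0r.
Qed.

HB.instance Definition _ := Lmodule_isNormed.Build R dual
  ler_dual_normD dual_normZ dual_norm0_eq0.

End Dual.

Section Reflexive.
Variables (R : realType) (X : normedModType R).

Fact bidual_eval_subproof (x : X) :
  (fun f : dual X => f x : R^o) \in @functional_pred R (dual X).
Proof.
rewrite inE.
have lx : scalar (fun f : dual X => f x : R^o) by [].
split => //.
pose ev : {linear dual X -> R^o} :=
  HB.pack (fun f : dual X => f x : R^o) (GRing.isLinear.Build R _ R^o *:%R _ lx).
apply: (@bounded_linear_continuous _ _ _ ev).
apply/bounded_funP => r; exists (r * `|x|) => f fr.
by rewrite (le_trans (dual_norm_apply f x))// ler_wpM2r.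
Qed.

(** The canonical embedding of [X] into its bidual. *)
Definition bidual_eval (x : X) : dual (dual X) := Dual (bidual_eval_subproof x).

Definition reflexive_space := forall Phi : dual (dual X), exists x, bidual_eval x = Phi.

End Reflexive.
Arguments reflexive_space {R} X.

(** * Bases *)

Section Bases.
Variables (R : realType) (Y : normedModType R) (e : nat -> Y).

Definition schauder_basis := forall y : Y,
  exists! a : nat -> R, series (fun j => a j *: e j) @ \oo --> y.

Definition normalized_seq := forall j, `|e j| = 1.

(** Stated on finite sums; for a basis this implies the same inequality for all
    convergent expansions, together with the convergence of the signed ones. *)
Definition unconditional1 := forall (n : nat) (a : nat -> R) (s : nat -> bool),
  `|\sum_(j < n) (-1) ^+ s j * a j *: e j| <= `|\sum_(j < n) a j *: e j|.

End Bases.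

(** * Families of finite sets of sequences *)

(** Only meaningful when [P] is nonempty; [0] otherwise. *)
Definition nat_min (P : set nat) : nat :=
  if pselect (exists n, `[< P n >]) is left ex then ex_minn ex else 0%N.

Lemma nat_minP (P : set nat) n : P n ->
  P (nat_min P) /\ forall m, P m -> (nat_min P <= m)%N.
Proof.
move=> Pn; rewrite /nat_min; case: pselect => [ex|[]]; last by exists n; apply/asboolP.
by case: ex_minnP => m /asboolP Pm mP; split => // k Pk; apply/mP/asboolP.
Qed.

Section Families.
Variable S : finType.

(** Sequences are indexed from [0], so that [p k] is the entry of index [k.+1]
    for the usual indexing from [1]; the value of [first_diff] follows the
    latter. *)
Definition first_diff (p q : nat -> S) : nat :=
  nat_min [set k.+1 | k in [set k | p k <> q k]].

Definition sharp (A : {fset (nat -> S)}) : nat :=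
  nat_min [set n | exists p q, [/\ p \in A, q \in A, p <> q & n = first_diff p q]].

Record admissible_families (F : nat -> set {fset (nat -> S)}) : Prop := {
  families0 : F 0%N = [set A | A = fset0 \/ exists p, A = [fset p]%fset];
  families_hereditary : forall n A B, (B `<=` A)%fset -> F n.+1 A -> F n.+1 B;
  families_incr : forall n, F n `<=` F n.+1;
  families_split : forall n A, F n.+1 A -> (2 <= #|` A|)%N ->
    exists2 B : 'I_(sharp A) -> {fset (nat -> S)},
      (forall i, F n (B i)) & A = (\bigcup_(i in 'I_(sharp A)) B i)%fset }.

Definition inclusion_a (F : nat -> set {fset (nat -> S)}) :=
  forall (n M : nat) (A : nat -> {fset (nat -> S)}),
    (1 <= n)%N ->
    (forall i j, i <> j -> [disjoint A i & A j]%fset) ->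
    (forall i, F n (A i)) ->
    (forall i, (2 <= #|` A i|)%N) ->
    (fun i => sharp (A i)) @ \oo --> \oo ->
    exists2 i : 'I_M -> nat,
      (forall k l : 'I_M, (k < l)%N -> (i k < i l)%N) &
      F n.+1 (\bigcup_(k in 'I_M) A (i k))%fset.

Definition inclusion_b (F : nat -> set {fset (nat -> S)}) :=
  forall (M : nat) (gamma : nat -> (nat -> S)),
    exists2 i : 'I_M -> nat,
      (forall k l : 'I_M, (k < l)%N -> (i k < i l)%N) &
      F 1%N [fset gamma (i k) | k in 'I_M]%fset.

Definition inclusion_condition (F : nat -> set {fset (nat -> S)}) :=
  inclusion_a F /\ inclusion_b F.

End Families.

(** * The space *)

Section C00.
Variables (R : realType) (T : Type).

Definition finsupp_pred : {pred T -> R^o} :=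
  mem [set x : T -> R^o | finite_set [set t | x t != 0]].

Fact finsupp_submod_closed : submod_closed finsupp_pred.
Proof.
split; first by rewrite inE /=; apply: sub_finite_set (finite_set0 T) => t /=; rewrite eqxx.
move=> a x y; rewrite !inE /= => fx fy.
have : finite_set ([set t | x t != 0] `|` [set t | y t != 0]).
  by rewrite finite_setU.
apply: sub_finite_set => t /=; rewrite !fctE => axy.
case: (eqVneq (x t) 0) => [x0|]; last by left.
by right; move: axy; rewrite x0 scaler0 add0r.
Qed.

HB.instance Definition _ := GRing.isSubmodClosed.Build R (T -> R^o)
  finsupp_pred finsupp_submod_closed.

Record c00 := C00 { coef :> T -> R^o; _ : coef \in finsupp_pred }.

HB.instance Definition _ := [isSub for coef].
HB.instance Definition _ := [Choice of c00 by <:].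
HB.instance Definition _ := [SubChoice_isSubLmodule of c00 by <:].

(** [(X, iota)] is the completion of [c00] for the norm [N]; it is determined
    up to isometric isomorphism. *)
Definition is_completion (N : c00 -> R) (X : completeNormedModType R)
    (iota : {linear c00 -> X}) :=
  (forall x, `|iota x| = N x) /\ dense (range iota).

End C00.

Section Norm.
Variables (R : realType) (S : finType) (F : nat -> set {fset (nat -> S)}).
Variables (Y : completeNormedModType R) (e : nat -> Y).

Definition family_norm (j : nat) (x : c00 R (nat -> S)) : R :=
  sup [set \sum_(gamma <- A) `|x gamma| | A in F j].

Definition space_norm (x : c00 R (nat -> S)) : R :=
  `|limn (series (fun j => (2^-1 ^+ j * family_norm j x) *: e j))|.

End Norm.

(* Main.v *)
From HB Require Import structures.
Require Import Defs.
From mathcomp Require Import all_boot all_order all_algebra finmap.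
From mathcomp Require Import all_classical all_reals all_analysis.
From mathcomp Require Import lra ring.

Set Implicit Arguments.
Unset Strict Implicit.
Unset Printing Implicit Defensive.

Import Order.TTheory GRing.Theory Num.Theory.
Import numFieldNormedType.Exports.

Local Open Scope classical_set_scope.
Local Open Scope ring_scope.

(** The space has the unit vectors as an unconditional basis, indexed by all
    sequences, and reflexivity is proved as in James' theorem for such bases: the
    basis is shrinking and boundedly complete. Both facts combine the reflexivity
    of [Y] with an analysis of disjoint vectors, through the profile of [x], the
    vector of [Y] with coordinates [2^-j * ||x||_j], whose norm is that of [x].

    Shrinking ([functional_small_off_finite]). If some functional [f] is not small
    off finite sets, there are disjoint vectors [x_i] of norm at most 1 with
    [f x_i >= eps]. When such vectors are small for the norm of rank [j], a sparse
    choice of them adds up as in [c0] for the norm of rank [j + 1]: a member [A] of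
    that rank meeting the support of an earlier vector twice has bounded [sharp A],
    hence is a bounded union of members of rank [j], on which the later vectors are
    negligible ([family_norm_succD]). Averaging therefore makes the norms of all
    ranks small, one rank after the other ([slice_small]), while [f] stays at least
    [eps]. The profiles obtained tend to 0 coordinatewise, hence weakly in the
    reflexive space [Y], and by convexity this is incompatible with the lower bound
    given by [f] on their positive combinations ([slice_eps_le0]).

    Boundedly complete ([norm_small_off_finite]). If the finite sections of a
    family [a] of scalars have bounded norms, their profiles are dominated by one
    vector of [Y], so only finitely many ranks matter, up to [eps]. For each rank
    the sections are small off a finite set ([small_mass_off_finite]): a first rank
    for which this fails would yield disjoint members of that rank on which [a] has
    mass at least [delta] and whose [sharp] tends to infinity, and the inclusion
    condition would put arbitrarily many of them in a single member of the next
    rank, whose mass is bounded.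

    The functional analysis rests on one version of the Hahn-Banach theorem,
    [hahn_banach_cone], which produces a functional above a convex cone of
    prescribed values, and on its consequence [weak_cluster_point] for bounded
    families in a reflexive space. *)

(** * Sublinear functionals and the Hahn-Banach theorem *)

Section Sublinear.
Variables (R : realType) (V : lmodType R).

Definition sublinear (q : V -> R) :=
  (forall x y, q (x + y) <= q x + q y) /\
  (forall (c : R) x, 0 < c -> q (c *: x) <= c * q x).

Definition convex_cone (K : V -> R -> Prop) :=
  [/\ K 0 0,
      forall x r y s, K x r -> K y s -> K (x + y) (r + s) &
      forall (c : R) x r, 0 < c -> K x r -> K (c *: x) (c * r)].

(** The largest sublinear minorant of [q] that forces [r <= f x] on [K] for every
    linear functional [f] below it. *)
Definition cone_inf (q : V -> R) (K : V -> R -> Prop) (x : V) : R :=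
  inf [set v | exists y r, K y r /\ v = q (x + y) - r].

Lemma sublinearB (q : V -> R) x y : sublinear q -> q x - q (- y) <= q (x + y).
Proof.
by move=> [qD _]; rewrite lerBlDr; have := qD (x + y) (- y); rewrite addrK.
Qed.

Lemma sublinear0 (q : V -> R) : sublinear q -> q 0 = 0.
Proof.
move=> [qD qZ]; apply/eqP; rewrite eq_le; apply/andP; split.
  by have := @qZ 2^-1 0; rewrite scaler0 invr_gt0 ltr0n => /(_ isT); lra.
by have := qD 0 0; rewrite addr0 lerDl.
Qed.

(** Both infima needed here, over the points of a cone and over a chain of
    functionals, are taken over index sets on which two values, at possibly
    different indices, are absorbed by a single index. *)
Lemma sublinear_inf (I : Type) (D : set I) (h : V -> I -> R) :
  D !=set0 ->
  (forall x, has_lbound [set h x i | i in D]) ->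
  (forall x y i j, D i -> D j -> exists2 k, D k & h (x + y) k <= h x i + h y j) ->
  (forall (c : R) x i, 0 < c -> D i -> exists2 k, D k & h (c *: x) k <= c * h x i) ->
  sublinear (fun x => inf [set h x i | i in D]).
Proof.
move=> [i0 Di0] lb hD hZ.
have ne x : [set h x i | i in D] !=set0 by exists (h x i0), i0.
have le x k : D k -> inf [set h x i | i in D] <= h x k.
  by move=> Dk; apply: ge_inf => //; exists k.
split=> [x y|c x c0].
- rewrite /= -lerBlDr; apply: lb_le_inf => // _ [i Di <-].
  rewrite lerBlDr -lerBlDl; apply: lb_le_inf => // _ [j Dj <-].
  rewrite lerBlDl; have [k Dk] := hD x y i j Di Dj.
  by apply: le_trans; exact: le.
- rewrite /= -ler_pdivrMl //; apply: lb_le_inf => // _ [i Di <-].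
  rewrite ler_pdivrMl //; have [k Dk] := hZ c x i c0 Di.
  by apply: le_trans; exact: le.
Qed.

Section ConeInf.
Variables (q : V -> R) (K : V -> R -> Prop).
Hypotheses (qsub : sublinear q) (Kcone : convex_cone K).
Hypothesis qK : forall x r, K x r -> r <= q x.

Let cone_inf_lb x :
  has_lbound [set v | exists y r, K y r /\ v = q (x + y) - r].
Proof.
exists (- q (- x)) => _ [y [r [Kyr ->]]].
have := sublinearB y x qsub; rewrite (addrC y) => h.
by have := qK Kyr; lra.
Qed.

Lemma cone_inf_le x y r : K y r -> cone_inf q K x <= q (x + y) - r.
Proof. by move=> Kyr; apply: ge_inf => //; exists y, r. Qed.

Lemma cone_inf_sublinear : sublinear (cone_inf q K).
Proof.
have [K0 KD KZ] := Kcone; have [qD qZ] := qsub.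
pose h x (p : V * R) := q (x + p.1) - p.2.
have E x : cone_inf q K x = inf [set h x p | p in [set p | K p.1 p.2]].
  congr (inf _); apply/seteqP; split=> [_ [y [r [Kyr ->]]]|_ [[y r] Kyr <-]].
    by exists (y, r).
  by exists y, r.
have -> : cone_inf q K = fun x => inf [set h x p | p in [set p | K p.1 p.2]].
  by apply/funext.
apply: sublinear_inf => [|x|x y [y1 r1] [y2 r2] /= K1 K2|c x [y r] c0 /= K1].
- by exists (0, 0).
- have [m mP] := cone_inf_lb x; exists m => _ [[y r] /= Kyr <-].
  by apply: mP; exists y, r.
- exists (y1 + y2, r1 + r2); first exact: KD.
  rewrite /h /= addrACA; have := qD (x + y1) (y + y2); lra.
- exists (c *: y, c * r); first exact: KZ.
  rewrite /h /= -scalerDr; have := qZ c (x + y) c0; lra.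
Qed.

Lemma cone_inf_self x : cone_inf q K x <= q x.
Proof.
have [K0 _ _] := Kcone.
by apply: le_trans (cone_inf_le x K0) _; rewrite addr0 subr0.
Qed.

Lemma cone_infN x r : K x r -> cone_inf q K (- x) <= - r.
Proof.
move=> Kxr; apply: le_trans (cone_inf_le _ Kxr) _.
by rewrite addNr sublinear0 // sub0r.
Qed.

End ConeInf.

(** Zorn's lemma for the reverse pointwise order: a chain of sublinear
    functionals below [p] has a sublinear infimum, finite because every
    sublinear [q <= p] satisfies [- p (- x) <= q x]. *)
Lemma minimal_sublinear (p : V -> R) : sublinear p ->
  exists q, [/\ sublinear q, forall x, q x <= p x &
    forall q', sublinear q' -> (forall x, q' x <= q x) -> q' = q].
Proof.
move=> psub.
pose T := {q : V -> R | sublinear q /\ forall x, q x <= p x}.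
pose r (q1 q2 : T) := `[< forall x, sval q2 x <= sval q1 x >].
have pp : sublinear p /\ forall x, p x <= p x by [].
have lb (q : T) x : - p (- x) <= sval q x.
  have [qsub qp] := svalP q; have := sublinearB 0 x qsub.
  by rewrite add0r sublinear0 //; have := qp (- x); lra.
have [||A Atot|q qmin] := @ZL_preorder T (exist _ p pp) r.
- by move=> q; apply/asboolP.
- move=> q1 q2 q3 /asboolP h1 /asboolP h2; apply/asboolP => x.
  exact: le_trans (h1 x).
- have [->|/set0P[q0 Aq0]] := eqVneq A set0; first by exists (exist _ p pp).
  pose m x := inf [set sval q x | q in A].
  have mlb x : has_lbound [set sval q x | q in A].
    by exists (- p (- x)) => _ [q Aq <-]; exact: lb.
  have msub : sublinear m.
    apply: (@sublinear_inf T A (fun x q => sval q x)) => //.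
    + by exists q0.
    + move=> x y q1 q2 A1 A2.
      have [/asboolP h|/asboolP h] := Atot _ _ A1 A2.
        exists q2 => //; apply: le_trans ((svalP q2).1.1 x y) _.
        by rewrite lerD2r.
      exists q1 => //; apply: le_trans ((svalP q1).1.1 x y) _.
      by rewrite lerD2l.
    + by move=> c x q c0 Aq; exists q => //; apply: (svalP q).1.2.
  have mle x q : A q -> m x <= sval q x.
    by move=> Aq; apply: ge_inf => //; exists q.
  have mp x : m x <= p x by apply: le_trans (mle x q0 Aq0) ((svalP q0).2 x).
  exists (exist _ m (conj msub mp)) => q Aq; apply/asboolP => x /=.
  exact: mle.
- exists (sval q); have [qsub qp] := svalP q; split=> // q' q'sub q'q.
  have q'p x : q' x <= p x by exact: le_trans (q'q x) (qp x).
  have /(_ _)/asboolP/= := qmin (exist _ q' (conj q'sub q'p)).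
  move=> h; apply/funext => x; apply/eqP; rewrite eq_le q'q /=; apply: h.
  exact/asboolP.
Qed.

(** Minimality forces oddness: lowering [q] along the ray through [y] gives a
    sublinear functional whose value at [- y] is at most [- q y], and by
    minimality this functional is [q] itself. An odd sublinear functional is
    linear. *)
Lemma minimal_sublinear_linear (q : V -> R) : sublinear q ->
  (forall q', sublinear q' -> (forall x, q' x <= q x) -> q' = q) ->
  (forall x y, q (x + y) = q x + q y) /\ forall c x, q (c *: x) = c * q x.
Proof.
move=> qsub qmin; have [qD qZ] := qsub.
have qN y : q (- y) = - q y.
  (* The cone generated by the single point [(y, q y)]. *)
  pose K (v : V) (r : R) := exists2 t : R, 0 <= t & v = t *: y /\ r = t * q y.
  have Kcone : convex_cone K.
    split.
    - by exists 0; rewrite // scale0r mul0r.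
    - move=> _ _ _ _ [t t0 [-> ->]] [s s0 [-> ->]].
      by exists (t + s); rewrite ?addr_ge0 // scalerDl mulrDl.
    - move=> c _ _ c0 [t t0 [-> ->]]; exists (c * t).
        by rewrite mulr_ge0 // ltW.
      by rewrite scalerA mulrA.
  have qK v r : K v r -> r <= q v.
    move=> [t]; rewrite le_eqVlt => /predU1P[<- [-> ->]|t0 [-> ->]].
      by rewrite mul0r scale0r sublinear0.
    have := qZ t^-1 (t *: y); rewrite scalerA mulVf ?gt_eqF// scale1r invr_gt0.
    by move=> /(_ t0); rewrite ler_pdivlMl.
  have eK := qmin _ (cone_inf_sublinear qsub Kcone qK) (cone_inf_self qsub Kcone qK).
  have Ky : K y (q y) by exists 1; rewrite // scale1r mul1r.
  have := cone_infN qsub qK Ky; rewrite eK => h.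
  by apply/eqP; rewrite eq_le h /= -subr_ge0 opprK -(sublinear0 qsub) addrC
    -[X in q X](subrr y).
have qZ' c x : 0 < c -> q (c *: x) = c * q x.
  move=> c0; apply/eqP; rewrite eq_le qZ //=.
  have := qZ c (- x) c0; rewrite scalerN !qN; lra.
split=> [x y|c x].
  apply/eqP; rewrite eq_le qD /=.
  by have := sublinearB x y qsub; rewrite qN opprK.
have [c0|c0|->] := ltgtP c 0; last by rewrite scale0r sublinear0 ?mul0r.
  have := qZ' (- c) x; rewrite oppr_gt0 => /(_ c0).
  by rewrite scaleNr qN mulNr => /oppr_inj.
exact: qZ'.
Qed.

End Sublinear.

Section NormedDual.
Variables (R : realType) (V : normedModType R).

Lemma dual_of_bound (g : V -> R) C :
  (forall x y, g (x + y) = g x + g y) -> (forall c x, g (c *: x) = c * g x) ->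
  (forall x, `|g x| <= C * `|x|) -> exists f : dual V, forall x, f x = g x.
Proof.
move=> gD gZ gC.
have lg : scalar (g : V -> R^o) by move=> a x y; rewrite gD gZ.
pose gl : {linear V -> R^o} :=
  HB.pack (g : V -> R^o) (GRing.isLinear.Build R V R^o *:%R g lg).
have cg : continuous (g : V -> R^o).
  apply: (@bounded_linear_continuous _ _ _ gl).
  apply/bounded_funP => r; exists (`|C| * r) => x xr.
  apply: (le_trans (gC x)); apply: (@le_trans _ _ (`|C| * `|x|)).
    by rewrite ler_wpM2r // ler_norm.
  by rewrite ler_wpM2l.
have gP : (g : V -> R^o) \in @functional_pred R V by rewrite inE.
by exists (Dual gP).
Qed.

(** The form of the Hahn-Banach theorem used throughout. Taking for [K] the graph
    of a functional on a subspace gives extension; taking for [K] a cone that is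
    not a subspace gives separation from a convex set, and also limits of
    bounded families of scalars. *)
Lemma hahn_banach_cone (K : V -> R -> Prop) C : 0 <= C ->
  convex_cone K -> (forall x r, K x r -> r <= C * `|x|) ->
  exists f : dual V, (forall x, `|f x| <= C * `|x|) /\
    forall x r, K x r -> r <= f x.
Proof.
move=> C0 Kcone KC.
have nsub : sublinear (fun x : V => C * `|x|).
  split=> [x y|c x c0]; first by rewrite -mulrDr ler_wpM2l // ler_normD.
  by rewrite normrZ (gtr0_norm c0) mulrCA.
have [q [qsub qle qmin]] := minimal_sublinear (cone_inf_sublinear nsub Kcone KC).
have [qD qZ] := minimal_sublinear_linear qsub qmin.
have qN x : q (- x) = - q x by rewrite -scaleN1r qZ mulN1r.
have qC x : q x <= C * `|x|.
  exact: le_trans (qle x) (cone_inf_self nsub Kcone KC x).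
have [|f fq] := @dual_of_bound q C qD qZ.
  by move=> x; rewrite ler_norml qC andbT lerNl -qN -(normrN x) qC.
exists f; split=> [x|x r Kxr]; rewrite fq.
  by rewrite ler_norml qC andbT lerNl -qN -(normrN x) qC.
by rewrite -lerN2 -qN; apply: le_trans (qle _) (cone_infN nsub KC Kxr).
Qed.

End NormedDual.

(** * Functionals and weak cluster points *)

Section Functionals.
Variables (R : realType) (V : normedModType R).

(** [T] is not supposed injective: the bound on [g] makes it factor through the
    range of [T]. *)
Lemma dual_extension (Z : lmodType R) (T : {linear Z -> V}) (g : Z -> R) (C : R) :
  (forall x y, g (x + y) = g x + g y) -> (forall c x, g (c *: x) = c * g x) ->
  0 <= C -> (forall z, `|g z| <= C * `|T z|) ->
  exists f : dual V, (forall x, `|f x| <= C * `|x|) /\ forall z, f (T z) = g z.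
Proof.
move=> gD gZ C0 gC.
have gN z : g (- z) = - g z by rewrite -scaleN1r gZ mulN1r.
pose K x r := exists z, x = T z /\ r = g z.
have Kc : convex_cone K.
  split.
  - by exists 0; have := gZ 0 0; rewrite linear0 scale0r mul0r.
  - by move=> _ _ _ _ [z [-> ->]] [t [-> ->]]; exists (z + t); rewrite linearD gD.
  - by move=> c _ _ _ [z [-> ->]]; exists (c *: z); rewrite linearZ gZ.
have [|f [fC fK]] := hahn_banach_cone C0 Kc.
  by move=> _ _ [z [-> ->]]; apply: le_trans (gC z); exact: ler_norm.
exists f; split=> // z; apply/eqP; rewrite eq_le.
rewrite [X in _ && X]fK; last by exists z.
by rewrite -lerN2 -gN -linearN -linearN fK //; exists (- z).
Qed.

Lemma norming_functional (x : V) :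
  exists f : dual V, (forall y, `|f y| <= `|y|) /\ f x = `|x|.
Proof.
pose K (y : V) (r : R) := exists2 t : R, 0 <= t & y = t *: x /\ r = t * `|x|.
have Kc : convex_cone K.
  split.
  - by exists 0; rewrite // scale0r mul0r.
  - move=> _ _ _ _ [t t0 [-> ->]] [s s0 [-> ->]].
    by exists (t + s); rewrite ?addr_ge0 // scalerDl mulrDl.
  - move=> c _ _ c0 [t t0 [-> ->]]; exists (c * t).
      by rewrite mulr_ge0 // ltW.
    by rewrite scalerA mulrA.
have [|f [fC fK]] := hahn_banach_cone ler01 Kc.
  by move=> _ _ [t t0 [-> ->]]; rewrite normrZ ger0_norm // mul1r.
exists f; split=> [y|]; first by rewrite -[leRHS]mul1r.
apply/eqP; rewrite eq_le fK; last by exists 1; rewrite ?scale1r ?mul1r.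
by rewrite andbT -[leRHS]mul1r; apply: le_trans (fC x); exact: ler_norm.
Qed.

(** A substitute for the weak compactness of balls. The inequalities that hold
    eventually along [G] form a convex cone in the product of the dual with the
    scalars; a functional above this cone is a point of the bidual, hence a
    vector. *)
Lemma weak_cluster_point : reflexive_space V ->
  forall (I : Type) (G : set_system I) (u : I -> V) (C : R),
  ProperFilter G -> 0 <= C -> (forall i, `|u i| <= C) ->
  exists y, forall (h : dual V) r, (\forall i \near G, r <= h (u i)) -> r <= h y.
Proof.
move=> rV I G u C GF C0 uC.
pose K (h : dual V) (r : R) := \forall i \near G, r <= h (u i).
have Kc : convex_cone K.
  split.
  - by apply: nearW => i; exact: lexx.
  - move=> h r k s; apply: filterS2 => i hi ki; exact: lerD.
  - by move=> c h r c0; apply: filterS => i hi; rewrite ler_pM2l.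
have [h r hr|Phi [_ PhiK]] := hahn_banach_cone C0 Kc.
  have [i hi] := filter_ex hr.
  apply: (le_trans hi); apply: le_trans (ler_norm _) _.
  apply: le_trans (dual_norm_apply h (u i)) _.
  by rewrite mulrC; apply: ler_wpM2r; [exact: dual_norm_ge0|exact: uC].
by have [y yPhi] := rV Phi; exists y => h r /PhiK; rewrite -yPhi.
Qed.

End Functionals.

(** * Unconditional bases *)

Section UnconditionalBasis.
Variables (R : realType) (Y : completeNormedModType R) (e : nat -> Y).

(** Convergent expansions are handled as a relation between coefficients and sum,
    which avoids choosing coordinates before they are known to be continuous. *)
Definition expands (a : nat -> R) (y : Y) :=
  series (fun j => a j *: e j) @ \oo --> y.

Lemma near_expands (a : nat -> R) (u : nat -> Y) y : u @ \oo --> y ->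
  (\forall n \near \oo, u n = series (fun j => a j *: e j) n) -> expands a y.
Proof. by move=> uy ua; apply: cvg_trans uy; exact: near_eq_cvg. Qed.

Lemma expandsD a b x y :
  expands a x -> expands b y -> expands (fun j => a j + b j) (x + y).
Proof.
move=> ax bx; apply: near_expands (cvgD ax bx) _.
apply: nearW => n; rewrite fctE /series /= -big_split /=.
by apply: eq_bigr => j _; rewrite scalerDl.
Qed.

Lemma expandsZ (c : R) a x : expands a x -> expands (fun j => c * a j) (c *: x).
Proof.
move=> ax; apply: near_expands (cvgZl_tmp (k := c) ax) _.
apply: nearW => n; rewrite /series /= scaler_sumr.
by apply: eq_bigr => j _; rewrite scalerA.
Qed.

Lemma expands0 : expands (fun=> 0) 0.
Proof.
apply: near_expands (cvg_cst (0 : Y)) _.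
by apply: nearW => n; rewrite /series /= big1 // => j _; rewrite scale0r.
Qed.

Lemma expands_tail a x m : expands a x ->
  expands (fun j => if (j < m)%N then 0 else a j)
    (x - \sum_(0 <= j < m) a j *: e j).
Proof.
move=> ax; apply: near_expands (cvgB ax (cvg_cst (\sum_(0 <= j < m) a j *: e j))) _.
exists m => // n /= mn; rewrite fctE /series /=.
rewrite (big_cat_nat (leq0n m) mn) /= [in RHS](big_cat_nat (leq0n m) mn) /=.
rewrite addrAC subrr add0r [X in _ = X + _]big_nat.
rewrite [X in _ = X + _]big1 ?add0r => [|j /andP[_ ->]]; last exact: scale0r.
rewrite big_nat [RHS]big_nat; apply: eq_bigr => j /andP[mj _].
by rewrite ltnNge mj.
Qed.

Hypothesis e_norm : normalized_seq e.
Hypothesis e_unc : unconditional1 e.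

(** Multiplying one coordinate by a scalar [t k] of [[-1, 1]] is a convex
    combination of leaving it and of changing its sign; the general case treats
    the coordinates one at a time. *)
Lemma unconditional_multiplier (t b : nat -> R) n : (forall i, `|t i| <= 1) ->
  `|\sum_(i < n) (t i * b i) *: e i| <= `|\sum_(i < n) b i *: e i|.
Proof.
move=> t1.
suff H k : `|\sum_(i < n) ((if (i < k)%N then t i else 1) * b i) *: e i|
    <= `|\sum_(i < n) b i *: e i|.
  by have := H n; under eq_bigr do rewrite ltn_ord.
elim: k => [|k IH]; first by under eq_bigr do rewrite ltn0 mul1r.
pose c i := (if (i < k)%N then t i else 1) * b i.
have -> : \sum_(i < n) ((if (i < k.+1)%N then t i else 1) * b i) *: e i =
    ((1 + t k) / 2) *: \sum_(i < n) c i *: e i +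
    ((1 - t k) / 2) *: \sum_(i < n) ((-1) ^+ (i == k :> nat) * c i) *: e i.
  rewrite !scaler_sumr -big_split /=; apply: eq_bigr => i _.
  rewrite !scalerA -scalerDl /c; congr (_ *: _).
  by rewrite ltnS leq_eqVlt; case: eqVneq => [->|ik] /=;
    rewrite ?ltnn ?expr1 ?expr0; field.
apply: le_trans (ler_normD _ _) _; rewrite !normrZ.
have := t1 k; rewrite ler_norml => /andP[tk1 tk2].
rewrite !ger0_norm ?divr_ge0 //; try lra.
have := e_unc n c (fun i => i == k); set s := `|_| => sc.
have : `|\sum_(i < n) c i *: e i| <= `|\sum_(i < n) b i *: e i| := IH.
set p := `|_| in sc *; set q := `|_| => pq.
apply: (@le_trans _ _ ((1 + t k) / 2 * q + (1 - t k) / 2 * q)); last by lra.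
apply: lerD; apply: ler_wpM2l; try lra.
Qed.

Lemma unconditional_mono (a b : nat -> R) n : (forall i, `|a i| <= `|b i|) ->
  `|\sum_(i < n) a i *: e i| <= `|\sum_(i < n) b i *: e i|.
Proof.
move=> ab; have -> : \sum_(i < n) a i *: e i = \sum_(i < n) (a i / b i * b i) *: e i.
  apply: eq_bigr => i _; have [b0|b0] := eqVneq (b i) 0; last by rewrite divfK.
  by have := ab i; rewrite b0 normr0 normr_le0 mulr0 => /eqP ->.
apply: (@unconditional_multiplier (fun i => a i / b i)) => i.
have [b0|b0] := eqVneq (b i) 0; first by rewrite b0 invr0 mulr0 normr0.
by rewrite normrM normfV ler_pdivrMr ?normr_gt0 // mul1r.
Qed.

Lemma expands_mono a b x y : (forall i, `|a i| <= `|b i|) ->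
  expands a x -> expands b y -> `|x| <= `|y|.
Proof.
move=> ab ax bx.
apply: (ler_cvg_to (cvg_norm ax) (cvg_norm bx)).
by apply: nearW => n; rewrite /series /= !big_mkord unconditional_mono.
Qed.

Lemma expands_unit j (c : R) : expands (fun i => if i == j then c else 0) (c *: e j).
Proof.
apply: near_expands (cvg_cst (c *: e j)) _.
exists j.+1 => // n /= jn; rewrite /series /= big_mkord (bigD1 (Ordinal jn)) //=.
rewrite eqxx big1 ?addr0 // => i; rewrite -val_eqE /= => /negPf ->.
by rewrite scale0r.
Qed.

Lemma expands_coord_le a x j : expands a x -> `|a j| <= `|x|.
Proof.
move=> ax; rewrite -[leLHS]mulr1 -(e_norm j) -normrZ.
apply: expands_mono _ (@expands_unit j (a j)) ax => i.
by case: eqVneq => [->|_] //; rewrite normr0.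
Qed.

(** The coordinates are continuous because [e] is normalized and unconditional:
    the term of index [j] of an expansion is no longer than its sum. *)
Lemma basis_coordinate j :
  exists f : dual Y, forall a y, expands a y -> f y = a j.
Proof.
pose K y (r : R) := exists2 a, expands a y & r = a j.
have Kc : convex_cone K.
  split.
  - by exists (fun=> 0) => //; exact: expands0.
  - move=> x _ y _ [a ax ->] [b bx ->].
    by exists (fun i => a i + b i) => //; exact: expandsD.
  - move=> c x _ _ [a ax ->].
    by exists (fun i => c * a i) => //; exact: expandsZ.
have [|f [_ fK]] := hahn_banach_cone ler01 Kc.
  move=> x _ [a ax ->]; rewrite mul1r; apply: le_trans (ler_norm _) _.
  exact: expands_coord_le.
exists f => a y ay; apply/eqP; rewrite eq_le.
rewrite [X in _ && X]fK; last by exists a.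
rewrite -lerN2 -linearN fK //; exists (fun i => -1 * a i); last by rewrite mulN1r.
by rewrite -scaleN1r; exact: expandsZ.
Qed.

(** All the expansions dominated by a convergent one have uniformly small tails,
    so up to [eps] their norms are controlled by finitely many coordinates. *)
Lemma expands_uniform_tail b y eps : expands b y -> 0 < eps ->
  exists m, forall a x, (forall j, `|a j| <= `|b j|) -> expands a x ->
    `|x| <= \sum_(0 <= j < m) `|a j| + eps.
Proof.
move=> bx eps0.
have /cvgrPdist_le/(_ _ eps0)[m _ /(_ m (leqnn m))/= mP] := bx.
exists m => a x ab ax.
rewrite -(subrK (\sum_(0 <= j < m) a j *: e j) x) addrC.
apply: le_trans (ler_normD _ _) _; apply: lerD.
  apply: le_trans (ler_norm_sum _ _ _) _; apply: ler_sum => j _.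
  by rewrite normrZ e_norm mulr1.
apply: le_trans _ mP.
apply: expands_mono _ (@expands_tail a x m ax) (@expands_tail b y m bx) => j.
by case: ifP.
Qed.

End UnconditionalBasis.

(** * Sums over finite sets *)

Section FsetSums.
Variables (R : realType) (T : choiceType).
Implicit Types (A B : {fset T}) (h : T -> R).

(** Sums over the members of a union are compared by spreading each of them over
    the whole union. *)
Lemma sum_fset_sub A B h : (A `<=` B)%fset ->
  \sum_(g <- A) h g = \sum_(g <- B | g \in A) h g.
Proof.
move=> AB; rewrite [RHS]big_mkcond -(big_fset_incl _ AB) /=.
  by rewrite [LHS]big_seq [RHS]big_seq; apply: eq_bigr => g ->.
by move=> g _ /negPf ->.
Qed.

Lemma ler_sum_fset A B h : (forall g, 0 <= h g) -> (A `<=` B)%fset ->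
  \sum_(g <- A) h g <= \sum_(g <- B) h g.
Proof.
move=> h0 AB; rewrite (sum_fset_sub h AB) big_mkcond.
by apply: ler_sum => g _; case: ifP.
Qed.

Lemma ler_sum_bigfcup (I : finType) (B : I -> {fset T}) h :
  (forall g, 0 <= h g) ->
  \sum_(g <- (\bigcup_(i in I) B i)%fset) h g <= \sum_i \sum_(g <- B i) h g.
Proof.
move=> h0; set U := (\bigcup_(i in I) B i)%fset.
have BU i : (B i `<=` U)%fset.
  by apply/fsubsetP => g gi; apply/bigfcupP; exists i; rewrite ?mem_index_enum.
under [leRHS]eq_bigr do rewrite (sum_fset_sub h (BU _)) big_mkcond.
rewrite exchange_big /= big_seq [leRHS]big_seq; apply: ler_sum => g gU.
have /bigfcupP[i _ gi] := gU; rewrite (bigD1 i) //= gi lerDl.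
by apply: sumr_ge0 => k _; case: ifP.
Qed.

Lemma sum_bigfcup_disjoint (I : finType) (B : I -> {fset T}) h :
  (forall g, 0 <= h g) -> (forall i j, i != j -> [disjoint B i & B j]%fset) ->
  \sum_i \sum_(g <- B i) h g <= \sum_(g <- (\bigcup_(i in I) B i)%fset) h g.
Proof.
move=> h0 dB; set U := (\bigcup_(i in I) B i)%fset.
have BU i : (B i `<=` U)%fset.
  by apply/fsubsetP => g gi; apply/bigfcupP; exists i; rewrite ?mem_index_enum.
under eq_bigr do rewrite (sum_fset_sub h (BU _)) big_mkcond.
rewrite exchange_big /= big_seq [leRHS]big_seq; apply: ler_sum => g gU.
have /bigfcupP[i _ gi] := gU; rewrite (bigD1 i) //= gi big1 ?addr0 // => k ki.
by case: ifP => // gk; have /fdisjointP/(_ _ gk) := dB _ _ ki; rewrite gi.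
Qed.

(** The filter of the inclusion order, along which finitely supported sections
    of a vector converge unconditionally. *)
Definition fset_directed : set_system {fset T} :=
  filter_from setT (fun A : {fset T} => [set B | (A `<=` B)%fset]).

#[global] Instance fset_directed_filter : ProperFilter fset_directed.
Proof.
apply: filter_from_proper; last by move=> A _; exists A => /=.
apply: filter_from_filter; first by exists fset0.
move=> A B _ _; exists (A `|` B)%fset => //= C /=.
by rewrite fsubUset => /andP[].
Qed.

Lemma near_fset_directed (A : {fset T}) :
  \forall B \near fset_directed, (A `<=` B)%fset.
Proof. by exists A. Qed.

(** Used for gliding humps: if a kind of finite set exists off every finite set,
    then infinitely many disjoint ones exist. *)
Lemma disjoint_sequence (P : nat -> {fset T} -> Prop) :
  (forall n A, exists2 B, [disjoint B & A]%fset & P n B) ->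
  exists2 B : nat -> {fset T}, forall n, P n (B n) &
    forall i j, i <> j -> [disjoint B i & B j]%fset.
Proof.
move=> PH; pose g n A := projT1 (cid2 (PH n A)).
have gd n A : [disjoint g n A & A]%fset by rewrite /g; case: cid2.
have gP n A : P n (g n A) by rewrite /g; case: cid2.
(* [U n] collects the sets chosen before step [n]. *)
pose fix U n : {fset T} := if n is k.+1 then (U k `|` g k (U k))%fset else fset0.
have Usub i j : (i <= j)%N -> (U i `<=` U j)%fset.
  elim: j => [|j IH]; first by rewrite leqn0 => /eqP ->.
  rewrite leq_eqVlt => /predU1P[->//|/IH h].
  by apply: fsubset_trans h _; exact: fsubsetUl.
have dlt i j : (i < j)%N -> [disjoint g j (U j) & g i (U i)]%fset.
  move=> ij; apply: fdisjointWr (gd j (U j)).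
  by apply: fsubset_trans (Usub _ _ ij); exact: fsubsetUr.
exists (fun n => g n (U n)) => // i j /eqP; rewrite neq_ltn => /orP[] ij.
  by rewrite fdisjoint_sym; exact: dlt.
exact: dlt.
Qed.

End FsetSums.

(** * Admissible families and the inclusion condition *)

Section Families.
Variables (R : realType) (S : finType) (F : nat -> set {fset (nat -> S)}).
Local Notation T := (nat -> S).
Hypothesis Fadm : admissible_families F.

Definition mass (a : T -> R) (A : {fset T}) : R := \sum_(g <- A) `|a g|.

Lemma family_fset0 n : F n fset0.
Proof.
elim: n => [|n IH]; last exact: (families_incr Fadm IH).
by rewrite (families0 Fadm); left.
Qed.

Lemma family_small n A : (#|` A| < 2)%N -> F n A.
Proof.
move=> A1; elim: n => [|n IH]; last exact: (families_incr Fadm IH).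
rewrite (families0 Fadm) /=; case: (fset_0Vmem A) => [->|[p pA]]; first by left.
right; exists p; apply/eqP; rewrite eq_sym eqEfcard fsub1set pA cardfs1.
by rewrite -ltnS.
Qed.

Lemma family0_card A : F 0%N A -> (#|` A| < 2)%N.
Proof.
by rewrite (families0 Fadm) => -[->|[p ->]]; rewrite ?cardfs0 ?cardfs1.
Qed.

Lemma family_sub n A B : (B `<=` A)%fset -> F n A -> F n B.
Proof.
case: n => [BA /family0_card A1|n]; last first.
  by move=> BA; exact: (families_hereditary Fadm BA).
by apply: family_small; apply: leq_ltn_trans A1; exact: fsubset_leq_card.
Qed.

Lemma sharp_le (A : {fset T}) p q : p \in A -> q \in A -> p <> q ->
  (sharp A <= Defs.first_diff p q)%N.
Proof.
move=> pA qA pq; rewrite /sharp; set P := [set n | _].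
have PF : P (Defs.first_diff p q) by exists p, q; split.
by have [_ h] := nat_minP PF; exact: h.
Qed.

Lemma mass_ge0 a A : 0 <= mass a A.
Proof. by apply: sumr_ge0. Qed.

(** The splitting axiom bounds the mass on a member of the family of rank [n.+1]
    by that on members of rank [n], at the price of the factor [sharp A]. Hence
    [sharp A] is large when [a] is uniformly small on the family of rank [n] but
    not on [A]. *)
Lemma mass_split n (a : T -> R) A c : F n.+1 A -> (2 <= #|` A|)%N ->
  (forall B, F n B -> (B `<=` A)%fset -> mass a B <= c) ->
  mass a A <= (sharp A)%:R * c.
Proof.
move=> FA A2 ac; have [B FB AB] := families_split Fadm FA A2.
rewrite {1}AB; apply: le_trans (ler_sum_bigfcup _ _) _ => //.
rewrite -[X in X%:R]card_ord mulr_natl -sumr_const.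
apply: ler_sum => i _; apply: ac => //; rewrite [X in (_ `<=` X)%fset]AB.
by apply/fsubsetP => g gi; apply/bigfcupP; exists i; rewrite ?mem_index_enum.
Qed.

Section SmallTails.
Variables (a : T -> R) (K : nat -> R).
Hypothesis aK : forall j A, F j A -> mass a A <= K j.
Hypothesis Finc : inclusion_condition F.

(** Arbitrarily many disjoint sets of mass at least [delta] whose union lies in
    one family contradict the bound on the masses over this family. *)
Lemma no_disjoint_copies n (B : nat -> {fset T}) delta : 0 < delta ->
  (forall i, delta <= mass a (B i)) ->
  (forall i j, i <> j -> [disjoint B i & B j]%fset) ->
  (forall M, exists2 i : 'I_M -> nat,
    (forall k l : 'I_M, (k < l)%N -> (i k < i l)%N) &
    F n (\bigcup_(k in 'I_M) B (i k))%fset) -> False.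
Proof.
move=> d0 Bd dB incB.
(* With this many copies the mass of the union exceeds [K n]. *)
pose M := (Num.bound (`|K n| / delta)).
have MK : K n < M%:R * delta.
  rewrite -ltr_pdivrMr //.
  apply: le_lt_trans (archi_boundP _); last by rewrite divr_ge0 // ltW.
  by rewrite ler_pM2r ?invr_gt0 // ler_norm.
have [i iinc FB] := incB M.
have ineq k l : k != l -> i k <> i l.
  rewrite -val_eqE neq_ltn => /orP[] /iinc h e; by rewrite e ltnn in h.
have /lt_le_trans : K n < mass a (\bigcup_(k in 'I_M) B (i k))%fset.
  apply: lt_le_trans MK _.
  apply: le_trans (sum_bigfcup_disjoint _ _) => // [|k l kl].
    rewrite -[X in X%:R]card_ord mulr_natl -sumr_const.
    by apply: ler_sum => k _; exact: Bd.
  exact/dB/ineq.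
by move=> /(_ _ (aK FB)); rewrite ltxx.
Qed.

(** The only place where the inclusion condition enters. If the conclusion fails
    at rank [m.+1], there are disjoint members of this rank of mass more than
    [delta] which, by the induction hypothesis, can be chosen with smaller and
    smaller masses over the family of rank [m]. Then their [sharp] tends to
    infinity by [mass_split], and part (a) puts many of them in one member of
    rank [m.+2]. At rank 0 the disjoint sets are singletons and part (b)
    applies. *)
Lemma small_mass_off_finite m delta : 0 < delta ->
  exists A0 : {fset T}, forall A, F m A -> [disjoint A & A0]%fset ->
    mass a A <= delta.
Proof.
elim: m delta => [|m IH] delta d0; apply: contrapT => /forallNP H.
  have PH (n : nat) A0 : exists2 B, [disjoint B & A0]%fset &
      exists p, B = [fset p]%fset /\ delta <= mass a B.
    have /existsNP[A /not_implyP[FA /not_implyP[dA /negP]]] := H A0.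
    rewrite -ltNge => mA; exists A => //.
    move: FA; rewrite (families0 Fadm) /= => -[A00|[p Ap]].
      by move: mA; rewrite A00 /mass big_seq_fset0 ltNge ltW.
    by exists p; split=> //; exact: ltW.
  have [B BP dB] := disjoint_sequence PH.
  have /choice[p pP] := BP.
  apply: (@no_disjoint_copies 1 B delta) => // [i|M]; first by have [] := pP i.
  have [i iinc Fi] := Finc.2 M p; exists i => //.
  suff -> : (\bigcup_(k in 'I_M) B (i k) = [fset p (i k) | k in 'I_M])%fset by [].
  apply/fsetP => g; apply/bigfcupP/imfsetP => [[k _]|[k /= _ ->]].
    by rewrite (pP (i k)).1 inE => /eqP ->; exists k.
  by exists k; rewrite ?mem_index_enum // (pP (i k)).1 inE.
have PH (n : nat) A0 : exists2 B, [disjoint B & A0]%fset &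
    [/\ F m.+1 B, delta < mass a B &
      forall C, F m C -> (C `<=` B)%fset -> mass a C <= delta / n.+1%:R].
  have [A1 A1P] := IH (delta / n.+1%:R) (divr_gt0 d0 (ltr0Sn _ _)).
  have /existsNP[A /not_implyP[FA /not_implyP[dA /negP]]] := H (A0 `|` A1)%fset.
  rewrite -ltNge => mA; move: dA; rewrite fdisjointXU => /andP[dA0 dA1].
  exists A => //; split=> // C FC CA; apply: A1P => //.
  exact: fdisjointWl dA1.
have [B BP dB] := disjoint_sequence PH.
have B2 i : (2 <= #|` B i|)%N.
  have [_ mB smB] := BP i; rewrite leqNgt; apply/negP => B1.
  have := smB _ (family_small m B1) (fsubset_refl _); apply/negP.
  rewrite -ltNge; apply: le_lt_trans mB.
  by rewrite ler_pdivrMr ?ltr0Sn // ler_peMr ?ler1n // ltW.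
have shB i : (i < sharp (B i))%N.
  have [FB mB smB] := BP i; have := lt_le_trans mB (mass_split FB (B2 i) smB).
  by rewrite mulrCA ltr_pMr // ltr_pdivlMr ?ltr0Sn // mul1r ltr_nat => /ltnW.
apply: (@no_disjoint_copies m.+2 B delta) => // [i|M].
  by have [_ /ltW] := BP i.
apply: Finc.1 => //.
  by move=> i; have [] := BP i.
apply/cvgnyPge => N; exists N => // n /= Nn.
exact/(leq_trans Nn)/ltnW/shB.
Qed.

End SmallTails.
End Families.

(** * Finitely supported functions and the family norms *)

Section C00.
Variables (R : realType) (T : choiceType).
Implicit Types (x y : c00 R T) (a : T -> R) (B : {fset T}).

Definition supp x : {fset T} := fset_set [set t | x t != 0].

Lemma mem_supp x t : (t \in supp x) = (x t != 0).
Proof.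
rewrite in_fset_set; first by apply/idP/idP; rewrite inE.
by have := valP x; rewrite inE.
Qed.

Lemma restriction_subproof a B :
  (fun t => if t \in B then a t else 0 : R^o) \in @finsupp_pred R T.
Proof.
rewrite inE /=; apply: (@sub_finite_set _ _ [set` B]) => // t /=.
by case: ifP => //; rewrite eqxx.
Qed.

Definition restriction a B : c00 R T := C00 (restriction_subproof a B).

Lemma restrictionE a B t : restriction a B t = if t \in B then a t else 0.
Proof. by []. Qed.

Lemma c00P x y : (forall t, x t = y t) -> x = y.
Proof. by move=> xy; apply/val_inj/funext. Qed.

Lemma c00D x y t : (x + y) t = x t + y t. Proof. by []. Qed.
Lemma c00Z (c : R) x t : (c *: x) t = c * x t. Proof. by []. Qed.
Lemma c00N x t : (- x) t = - x t. Proof. by []. Qed.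

Definition unit_vector t : c00 R T := restriction (fun=> 1) [fset t]%fset.

Lemma restriction_sum a B :
  restriction a B = \sum_(t <- B) a t *: unit_vector t.
Proof.
apply: c00P => s.
have -> : (\sum_(t <- B) a t *: unit_vector t : c00 R T) s
    = \sum_(t <- B) a t * unit_vector t s.
  by elim/big_rec2: _ => //= t u v _ <-.
rewrite restrictionE; under eq_bigr do rewrite restrictionE inE.
case: ifPn => sB.
  rewrite (big_fsetD1 s) //= eqxx mulr1 big_seq big1 ?addr0 // => t.
  by rewrite !inE => /andP[/negPf ts _]; rewrite eq_sym ts mulr0.
rewrite big_seq big1 // => t tB; case: eqP => [st|]; last by rewrite mulr0.
by move: sB; rewrite st tB.
Qed.

End C00.

Section FamilyNorm.
Variables (R : realType) (S : finType) (F : nat -> set {fset (nat -> S)}).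
Local Notation T := (nat -> S).
Hypothesis Fadm : admissible_families F.
Implicit Types (x y z : c00 R T).

Lemma mass_le_supp x A : mass x A <= mass x (supp x).
Proof.
rewrite /mass -(@big_fset_incl _ _ _ _ (supp x `&` A)%fset A).
- by apply: ler_sum_fset => //; exact: fsubsetIl.
- exact: fsubsetIr.
- move=> t tA; rewrite inE tA andbT mem_supp negbK => /eqP ->.
  by rewrite normr0.
Qed.

Lemma family_norm_ub j x A : F j A -> mass x A <= family_norm F j x.
Proof.
move=> FA; apply: ub_le_sup; last by exists A.
by exists (mass x (supp x)) => _ [B _ <-]; exact: mass_le_supp.
Qed.

Lemma family_norm_le j x c :
  (forall A, F j A -> mass x A <= c) -> family_norm F j x <= c.
Proof.
move=> xc; apply: ge_sup; last by move=> _ [A FA <-]; exact: xc.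
by exists (mass x fset0), fset0 => //; exact: family_fset0.
Qed.

Lemma family_norm_ge0 j x : 0 <= family_norm F j x.
Proof.
by apply: le_trans (family_norm_ub x (family_fset0 Fadm j)); exact: mass_ge0.
Qed.

Lemma family_norm_le_supp j x : family_norm F j x <= mass x (supp x).
Proof. by apply: family_norm_le => A _; exact: mass_le_supp. Qed.

Lemma massD x y A : mass (x + y) A <= mass x A + mass y A.
Proof.
by rewrite /mass -big_split /=; apply: ler_sum => t _; exact: ler_normD.
Qed.

Lemma family_normD j x y :
  family_norm F j (x + y) <= family_norm F j x + family_norm F j y.
Proof.
apply: family_norm_le => A FA; apply: le_trans (massD x y A) _.
by apply: lerD; exact: family_norm_ub.
Qed.

Lemma family_normZ j (c : R) x :
  family_norm F j (c *: x) <= `|c| * family_norm F j x.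
Proof.
apply: family_norm_le => A FA.
have -> : mass (c *: x) A = `|c| * mass x A.
  by rewrite /mass mulr_sumr; apply: eq_bigr => t _; rewrite c00Z normrM.
by apply: ler_wpM2l => //; exact: family_norm_ub.
Qed.

Lemma family_norm_mono j x y : (forall t, `|x t| <= `|y t|) ->
  family_norm F j x <= family_norm F j y.
Proof.
move=> xy; apply: family_norm_le => A FA; apply: le_trans (family_norm_ub y FA).
by apply: ler_sum.
Qed.

Lemma family_norm_incr j k x : (j <= k)%N ->
  family_norm F j x <= family_norm F k x.
Proof.
elim: k => [|k IH]; first by rewrite leqn0 => /eqP ->.
rewrite leq_eqVlt => /predU1P[->//|/IH h]; apply: le_trans h _.
apply: family_norm_le => A FA; apply: family_norm_ub.
exact: (families_incr Fadm FA).
Qed.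

(** The family of rank 0 gives the supremum norm, since its nonempty members
    are the singletons. *)
Lemma family_norm_rank0D x y c : [disjoint supp x & supp y]%fset ->
  family_norm F 0 x <= c -> family_norm F 0 y <= c -> family_norm F 0 (x + y) <= c.
Proof.
move=> /fdisjointP dxy xc yc; apply: family_norm_le => A FA.
have := FA; rewrite (families0 Fadm) => -[A0|[p Ap]].
  rewrite A0 /mass big_seq_fset0; exact: le_trans (family_norm_ge0 0 x) xc.
have := dxy p; rewrite !mem_supp negbK => h.
have [xp|xp] := eqVneq (x p) 0.
  apply: le_trans yc; apply: le_trans (family_norm_ub y FA).
  by rewrite Ap /mass !big_seq_fset1 c00D xp add0r.
apply: le_trans xc; apply: le_trans (family_norm_ub x FA).
by rewrite Ap /mass !big_seq_fset1 c00D (eqP (h xp)) addr0.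
Qed.

(** The estimate that makes long sums of disjoint vectors behave as in [c0]. If a
    member [A] of rank [j.+1] has two points in the support of [x], then
    [sharp A] is at most the largest first difference [D] of points of this
    support, and the contribution of [z] is at most [D] times its norm of
    rank [j]. Otherwise [A] sees at most one coordinate of [x]. *)
Lemma family_norm_succD (j : nat) x (c c' d : R) :
  family_norm F 0 x <= c -> family_norm F j.+1 x <= c' ->
  exists D : nat, forall z, family_norm F j.+1 z <= c ->
    D%:R * family_norm F j z <= d ->
    family_norm F j.+1 (x + z) <= Num.max (c + c) (c' + d).
Proof.
move=> xc xc'.
(* A bound for [sharp A] whenever [A] has two points in the support of [x]. *)
pose D := (\max_(p <- supp x) \max_(q <- supp x) Defs.first_diff p q)%N.
exists D => z zc zd; apply: family_norm_le => A FA.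
apply: le_trans (massD x z A) _; rewrite le_max.
have [A2|A1] := leqP 2 #|` (A `&` supp x)%fset|.
- apply/orP; right; apply: lerD.
    exact: le_trans (family_norm_ub x FA) xc'.
  have AA2 : (2 <= #|` A|)%N.
    by apply: leq_trans A2 _; apply: fsubset_leq_card; exact: fsubsetIl.
  have sA : (sharp A <= D)%N.
    have [p [q [pA qA pq]]] : exists p q,
        [/\ p \in (A `&` supp x)%fset, q \in (A `&` supp x)%fset & p <> q].
      case: (fset_0Vmem (A `&` supp x)%fset) => [E|[p pA]].
        by move: A2; rewrite E cardfs0.
      case: (fset_0Vmem ((A `&` supp x) `\ p)%fset) => [E|[q]].
        by move: A2; rewrite (cardfsD1 p) pA E cardfs0.
      rewrite inE in_fset1 => /andP[/eqP qp qA]; exists p, q; split=> // e.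
      exact: qp.
    move: pA qA; rewrite !in_fsetI => /andP[pA px] /andP[qA qx].
    apply: leq_trans (sharp_le pA qA pq) _.
    pose M r := (\max_(q <- supp x) Defs.first_diff r q)%N.
    apply: (@leq_trans (M p)); first exact: leq_bigmax_seq.
    exact: (leq_bigmax_seq (F := M)).
  apply: le_trans (mass_split Fadm FA AA2 (c := family_norm F j z) _) _.
    by move=> B FB _; exact: family_norm_ub.
  apply: le_trans zd; apply: ler_wpM2r; first exact: family_norm_ge0.
  by rewrite ler_nat.
- apply/orP; left; apply: lerD; last exact: le_trans (family_norm_ub z FA) zc.
  apply: le_trans xc.
  apply: le_trans (family_norm_ub x (family_small Fadm 0 A1)).
  rewrite /mass (@big_fset_incl _ _ _ _ (A `&` supp x)%fset A) //.
    exact: fsubsetIl.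
  move=> t tA; rewrite inE tA mem_supp negbK => /eqP ->.
  by rewrite normr0.
Qed.

End FamilyNorm.

(** * The norm of the space *)

Section SpaceNorm.
Variables (R : realType) (S : finType) (F : nat -> set {fset (nat -> S)}).
Variables (Y : completeNormedModType R) (e : nat -> Y).
Hypothesis Fadm : admissible_families F.
Hypotheses (e_norm : normalized_seq e) (e_unc : unconditional1 e).
Local Notation T := (nat -> S).
Implicit Types (x y z : c00 R T).

(** Norms in the space are compared through the coordinates of these vectors of
    [Y], where a larger expansion has a larger norm. *)
Definition profile_coord x j : R := 2^-1 ^+ j * family_norm F j x.
Definition profile x : Y := limn (series (fun j => profile_coord x j *: e j)).

Lemma norm_profile x : `|profile x| = space_norm F e x.
Proof. by []. Qed.

Lemma profile_coord_ge0 x j : 0 <= profile_coord x j.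
Proof. by rewrite mulr_ge0 ?exprn_ge0 // family_norm_ge0. Qed.

Lemma expands_profile x : expands e (profile_coord x) (profile x).
Proof.
suff : cvgn (series (fun j => profile_coord x j *: e j)) by [].
apply: normed_cvg.
apply: (@series_le_cvg R _ (geometric (mass x (supp x)) 2^-1)).
- by move=> n; exact: normr_ge0.
- by move=> n; rewrite /= mulr_ge0 ?mass_ge0 // exprn_ge0.
- move=> n /=; rewrite normrZ e_norm mulr1 ger0_norm ?profile_coord_ge0 // /profile_coord mulrC.
  by rewrite ler_wpM2r ?exprn_ge0 ?invr_ge0 // family_norm_le_supp.
- by apply: is_cvg_geometric_series; rewrite ger0_norm ?invf_lt1 ?ltr1n.
Qed.

Lemma space_norm_mono x y : (forall t, `|x t| <= `|y t|) ->
  space_norm F e x <= space_norm F e y.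
Proof.
move=> xy; rewrite -!norm_profile.
apply: (expands_mono e_unc _ (@expands_profile x) (@expands_profile y)) => j.
rewrite !ger0_norm ?profile_coord_ge0 // ler_wpM2l ?exprn_ge0 //.
exact: family_norm_mono.
Qed.

Lemma family_norm_le_space j x : family_norm F j x <= 2 ^+ j * space_norm F e x.
Proof.
rewrite -ler_pdivrMl ?exprn_gt0 // -exprVn -norm_profile.
rewrite -[leLHS]ger0_norm ?profile_coord_ge0 //.
exact: (expands_coord_le e_norm e_unc j (@expands_profile x)).
Qed.

Lemma coef_le_space x t : `|x t| <= space_norm F e x.
Proof.
have := family_norm_le_space 0 x; rewrite expr0 mul1r; apply: le_trans.
have -> : `|x t| = mass x [fset t]%fset by rewrite /mass big_seq_fset1.
by apply: family_norm_ub; apply: (family_small Fadm); rewrite cardfs1.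
Qed.

End SpaceNorm.

(** * The completion *)

Section Completion.
Variables (R : realType) (S : finType) (F : nat -> set {fset (nat -> S)}).
Variables (Y : completeNormedModType R) (e : nat -> Y).
Variables (X : completeNormedModType R).
Variable iota : {linear c00 R (nat -> S) -> X}.
Local Notation T := (nat -> S).
Hypothesis Fadm : admissible_families F.
Hypothesis Yrefl : reflexive_space Y.
Hypotheses (e_basis : schauder_basis e) (e_norm : normalized_seq e).
Hypothesis e_unc : unconditional1 e.
Hypothesis iotaN : forall x, `|iota x| = space_norm F e x.
Implicit Types (x y z w : c00 R T).

Lemma supp_add_disjoint x y A : [disjoint supp x & A]%fset ->
  [disjoint supp y & A]%fset -> [disjoint supp (x + y)%R & A]%fset.
Proof.
move=> /fdisjointP xA /fdisjointP yA; apply/fdisjointP => t.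
rewrite mem_supp c00D => xyt; have [xt|xt] := eqVneq (x t) 0.
  by apply: yA; rewrite mem_supp; move: xyt; rewrite xt add0r.
by apply: xA; rewrite mem_supp.
Qed.

Lemma supp_scale_disjoint (c : R) x A : [disjoint supp x & A]%fset ->
  [disjoint supp (c *: x)%R & A]%fset.
Proof.
move=> /fdisjointP xA; apply/fdisjointP => t.
by rewrite mem_supp c00Z mulf_eq0 negb_or => /andP[_ xt]; apply: xA; rewrite mem_supp.
Qed.

Lemma supp0_disjoint A : [disjoint supp (0 : c00 R T) & A]%fset.
Proof. by apply/fdisjointP => t; rewrite mem_supp eqxx. Qed.

Lemma family_norm0 j : family_norm F j (0 : c00 R T) = 0.
Proof.
apply/eqP; rewrite eq_le family_norm_ge0 // andbT.
by have := family_normZ Fadm j 0 (0 : c00 R T); rewrite scale0r normr0 mul0r.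
Qed.

Section Slice.
Variables (f : dual X) (eps : R).

(** For [m = 1] this is a slice of the unit ball; the set for [m] is the dilate
    by [m], so that sums of [m] elements of the slice lie in it and averages lie
    in the slice again. *)
Definition slice (m : nat) z :=
  `|iota z| <= m%:R /\ m%:R * eps <= f (iota z).

Hypothesis slice_off : forall A : {fset T},
  exists2 z, [disjoint supp z & A]%fset & slice 1 z.

Lemma sliceD m n x y : slice m x -> slice n y -> slice (m + n) (x + y).
Proof.
move=> [xm fx] [yn fy]; split; rewrite linearD natrD.
  by apply: le_trans (ler_normD _ _) _; exact: lerD.
by rewrite mulrDl linearD; exact: lerD.
Qed.

Lemma slice_average m x : slice m.+1 x -> slice 1 (m.+1%:R^-1 *: x).
Proof.
have m0 : 0 < m.+1%:R :> R by [].
move=> [xm fx]; split; rewrite linearZ /=.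
  by rewrite normrZ gtr0_norm ?invr_gt0 // ler_pdivrMl // mulr1.
by rewrite linearZ /= mul1r ler_pdivlMl.
Qed.

Lemma slice0 : slice 0 0.
Proof. by split; rewrite !linear0 ?normr0 // mul0r. Qed.

Lemma slice_family_norm j z : slice 1 z -> family_norm F j z <= 2 ^+ j.
Proof.
move=> [z1 _]; apply: le_trans (family_norm_le_space Fadm e_norm e_unc j z) _.
by rewrite -iotaN ler_piMr ?exprn_ge0.
Qed.

(** Summing disjoint elements of the slice does not increase the supremum
    norm. *)
Lemma slice_sum0 A m :
  exists w, [/\ [disjoint supp w & A]%fset, slice m w & family_norm F 0 w <= 1].
Proof.
elim: m => [|m [w [wA wm w1]]].
  exists 0; split; [exact: supp0_disjoint|exact: slice0|].
  by rewrite family_norm0.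
have [z] := slice_off (A `|` supp w)%fset.
rewrite fdisjointXU => /andP[zA zw] z1; exists (w + z); split.
- exact: supp_add_disjoint.
- by rewrite -addn1; exact: sliceD.
- apply: family_norm_rank0D => //; first by rewrite fdisjoint_sym.
  exact: slice_family_norm z1.
Qed.

(** The summands are chosen successively, each disjoint from the sum of the
    previous ones and so small in the norm of rank [j] that, by
    [family_norm_succD], it raises the bound on the norm of rank [j.+1] by no
    more than [delta]. The constant [2 ^+ j.+1] bounds this norm on the unit
    ball. *)
Lemma slice_sum j A m delta : 0 < delta ->
  (forall A' eta, 0 < eta -> exists z, [/\ [disjoint supp z & A']%fset,
     slice 1 z & family_norm F j z <= eta]) ->
  exists w, [/\ [disjoint supp w & A]%fset, slice m w,
    family_norm F 0 w <= 2 ^+ j.+1 &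
    family_norm F j.+1 w <= 2 ^+ j.+1 + 2 ^+ j.+1 + m%:R * delta].
Proof.
move=> d0 small; elim: m => [|m [w [wA wm w0 wj]]].
  exists 0; split; [exact: supp0_disjoint|exact: slice0| |];
    by rewrite family_norm0 ?mul0r ?addr_ge0 ?exprn_ge0.
have [D DP] := family_norm_succD Fadm delta w0 wj.
have [|z []] := small (A `|` supp w)%fset (delta / D.+1%:R).
  by rewrite divr_gt0.
rewrite fdisjointXU => /andP[zA zw] z1 zj; exists (w + z); split.
- exact: supp_add_disjoint.
- by rewrite -addn1; exact: sliceD.
- apply: family_norm_rank0D => //; first by rewrite fdisjoint_sym.
  apply: le_trans (family_norm_incr Fadm z (leq0n j.+1)) _.
  exact: slice_family_norm z1.
- apply: le_trans (DP z _ _) _; first exact: slice_family_norm z1.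
    apply: le_trans (ler_wpM2l (ler0n _ D) zj) _.
    rewrite mulrCA ger_pMr // ler_pdivrMr // mul1r ler_nat.
    exact: leqnSn.
  rewrite ge_max; apply/andP; split.
    by rewrite lerDl mulr_ge0 // ltW.
  by rewrite -[m.+1]addn1 natrD mulrDl mul1r addrA.
Qed.

(** Long averages of the sums above have small norms of any given rank: dividing
    by the number of summands makes the constant part negligible and leaves only
    the small increment [delta]. *)
Lemma slice_small j A eta : 0 < eta ->
  exists z, [/\ [disjoint supp z & A]%fset, slice 1 z & family_norm F j z <= eta].
Proof.
elim: j A eta => [|j IH] A eta eta0.
  (* [m.+1] summands: the norm of rank 0 of their sum stays at most 1. *)
  have [m] : exists m : nat, 1 <= m.+1%:R * eta.
    exists (Num.bound eta^-1); rewrite -ler_pdivrMr // mul1r ltW //.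
    apply: lt_trans (archi_boundP _) _; first by rewrite invr_ge0 ltW.
    by rewrite ltr_nat.
  move=> mP; have [w [wA wm w1]] := slice_sum0 A m.+1.
  exists (m.+1%:R^-1 *: w); split; [exact: supp_scale_disjoint|exact: slice_average|].
  apply: le_trans (family_normZ Fadm _ _ _) _.
  rewrite gtr0_norm ?invr_gt0 // ler_pdivrMl //; exact: le_trans mP.
set C : R := 2 ^+ j.+1 + 2 ^+ j.+1.
have C0 : 0 < C by rewrite addr_gt0 ?exprn_gt0.
have eta2 : 0 < eta / 2 by rewrite divr_gt0.
have [m mP] : exists m : nat, C <= m.+1%:R * (eta / 2).
  exists (Num.bound (C / (eta / 2))); rewrite -ler_pdivrMr // ltW //.
  apply: lt_trans (archi_boundP _) _; first by rewrite ltW // divr_gt0.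
  by rewrite ltr_nat.
have [w [wA wm w0 wj]] := slice_sum A m.+1 eta2 IH.
exists (m.+1%:R^-1 *: w); split; [exact: supp_scale_disjoint|exact: slice_average|].
apply: le_trans (family_normZ Fadm _ _ _) _.
rewrite gtr0_norm ?invr_gt0 // ler_pdivrMl //.
apply: (le_trans wj); rewrite -/C; apply: (le_trans (lerD mP (lexx _))).
by rewrite -mulrDr -splitr.
Qed.

(** This cone transports [f] from the space to [Y]: a functional above it is at
    least [f (iota z)] on every vector of [Y] whose coordinates dominate those of
    the profile of [z]. *)
Lemma dominated_cone :
  convex_cone (fun (v : Y) (r : R) => exists z b, [/\ expands e b v,
    forall j, profile_coord F z j <= b j & r <= f (iota z)]).
Proof.
split.
- exists 0, (fun=> 0); split; first exact: expands0.
    by move=> j; rewrite /profile_coord family_norm0 mulr0.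
  by rewrite !linear0.
- move=> x r y s [z [b [bx zb rz]]] [z' [b' [by' zb' sz]]].
  exists (z + z'), (fun j => b j + b' j); split; first exact: expandsD.
    move=> j; apply: le_trans (lerD (zb j) (zb' j)).
    by rewrite -mulrDr ler_wpM2l ?exprn_ge0 // family_normD.
  by rewrite !linearD; exact: lerD.
- move=> c x r c0 [z [b [bx zb rz]]].
  exists (c *: z), (fun j => c * b j); split; first exact: expandsZ.
    move=> j; apply: le_trans (ler_wpM2l (ltW c0) (zb j)).
    rewrite mulrCA ler_wpM2l ?exprn_ge0 //.
    by apply: le_trans (family_normZ Fadm _ _ _) _; rewrite gtr0_norm.
  by rewrite !linearZ /= ler_pM2l.
Qed.

(** Suppose that a slice has elements off every finite set. By [slice_small] it
    contains [y k] with norm of rank [k] tending to 0, so that the profiles of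
    the [y k] tend to 0 coordinatewise; by reflexivity of [Y] their weak cluster
    point is 0. A functional above [dominated_cone] is at least [eps] on all the
    profiles, hence at the cluster point. *)
Lemma slice_eps_le0 : eps <= 0.
Proof.
have [g [_ gP]] : exists g : dual Y, (forall v, `|g v| <= dual_norm f * `|v|) /\
    forall v r, (exists z b, [/\ expands e b v,
      forall j, profile_coord F z j <= b j & r <= f (iota z)]) -> r <= g v.
  apply: hahn_banach_cone dominated_cone _; first exact: dual_norm_ge0.
  move=> v r [z [b [bv zb rz]]]; apply: (le_trans rz).
  apply: le_trans (ler_norm _) _; apply: le_trans (dual_norm_apply f _) _.
  apply: ler_wpM2l; first exact: dual_norm_ge0.
  rewrite iotaN -norm_profile.
  apply: (expands_mono e_unc _ (@expands_profile _ _ _ _ _ Fadm e_norm z) bv) => j.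
  have z0 := profile_coord_ge0 Fadm z j.
  by rewrite !ger0_norm //; exact: le_trans (zb j).
have /choice[y yP] (k : nat) : exists z, slice 1 z /\
    family_norm F k z <= k.+1%:R^-1.
  have [|z [_ z1 zk]] := @slice_small k fset0 k.+1%:R^-1; first by rewrite invr_gt0.
  by exists z.
have [|v vP] := weak_cluster_point Yrefl (u := fun k => profile F e (y k))
  (G := \oo) _ ler01.
  by move=> k; rewrite norm_profile -iotaN; exact: (yP k).1.1.
(* The coordinates of [v] are limits of those of the profiles. *)
have v0 : v = 0.
  have [a [av _]] := e_basis v.
  suff a0 j : a j = 0.
    have: `|v| <= `|0 : Y|.
      by apply: (expands_mono e_unc _ av (expands0 e)) => j; rewrite a0.
    by rewrite normr0 normr_le0 => /eqP.
  have [h hP] := basis_coordinate e_norm e_unc j.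
  have hk k : h (profile F e (y k)) = profile_coord F (y k) j.
    exact: (hP _ _ (@expands_profile _ _ _ _ _ Fadm e_norm (y k))).
  rewrite -(hP _ _ av); apply/eqP; rewrite eq_le; apply/andP; split; last first.
    by apply: vP; apply: nearW => k; rewrite hk profile_coord_ge0.
  apply/ler_addgt0Pr => eta eta0; rewrite add0r -lerN2.
  apply: (vP (- h)); near=> k.
  have -> : (- h) (profile F e (y k)) = - h (profile F e (y k)) by [].
  rewrite lerN2 hk; apply: (@le_trans _ _ k.+1%:R^-1).
    apply: (@le_trans _ _ (family_norm F j (y k))).
      rewrite ler_piMl ?family_norm_ge0 // exprn_ile1 ?invr_ge0 // invf_le1 //.
      by rewrite ler1n.
    apply: le_trans (yP k).2; apply: family_norm_incr => //.
    by near: k; exact: nbhs_infty_ge.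
  by apply: ltW; near: k; exact: near_infty_natSinv_lt (PosNum eta0).
rewrite -(linear0 g) -v0; apply: vP; apply: nearW => k; apply: gP.
exists (y k), (profile_coord F (y k)); split=> //.
  exact: expands_profile.
by have [[_ +] _] := yP k; rewrite mul1r.
Unshelve. all: by end_near.
Qed.

End Slice.

(** The basis of the space is shrinking: otherwise the vectors at which the
    estimate fails, normalized and with the right sign, provide elements off
    every finite set in a slice with [eps > 0], against [slice_eps_le0]. *)
Lemma functional_small_off_finite (f : dual X) eps : 0 < eps ->
  exists A : {fset T}, forall z, [disjoint supp z & A]%fset ->
    `|f (iota z)| <= eps * `|iota z|.
Proof.
move=> eps0; apply: contrapT => /forallNP H.
have /(@slice_eps_le0 f eps) : forall A : {fset T},
    exists2 z, [disjoint supp z & A]%fset & slice f eps 1 z.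
  move=> A; have /existsNP[z /not_implyP[zA /negP]] := H A; rewrite -ltNge => fz.
  have z0 : 0 < `|iota z|.
    rewrite lt_neqAle normr_ge0 andbT eq_sym normr_eq0; apply: contraTneq fz => ->.
    by rewrite linear0 !normr0 mulr0 ltxx.
  (* Normalize [z] and choose its sign so that [f] is positive on it. *)
  exists ((Num.sg (f (iota z)) / `|iota z|) *: z); first exact: supp_scale_disjoint.
  split.
    rewrite linearZ normrZ normrM normfV normr_id -mulrA mulVf ?gt_eqF // mulr1.
    by rewrite normr_sg; case: eqP.
  have fE c : f (iota (c *: z)) = c * f (iota z) by rewrite !linearZ.
  by rewrite fE mul1r mulrAC -normrEsg ler_pdivlMr //; exact: ltW.
by rewrite leNgt eps0.
Qed.

Hypothesis Finc : inclusion_condition F.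

(** The basis of the space is boundedly complete. The profiles of the finite
    sections of [a] are bounded and increasing, so a weak cluster point in [Y]
    has an expansion that dominates all of them, and up to [eps / 2] the norm of
    a section depends only on the finitely many norms of rank at most [m]. Those
    are small off a finite set by [small_mass_off_finite]. *)
Lemma norm_small_off_finite (a : T -> R) C eps :
  (forall B, `|iota (restriction a B)| <= C) -> 0 < eps ->
  exists A : {fset T}, forall B, [disjoint B & A]%fset ->
    `|iota (restriction a B)| <= eps.
Proof.
move=> aC eps0.
have C0 : 0 <= C by apply: le_trans (aC fset0).
have massE B A : mass (restriction a B) A = mass a (A `&` B)%fset.
  rewrite /mass (sum_fset_sub _ (fsubsetIl A B)) [RHS]big_mkcond /=.
  rewrite big_seq [RHS]big_seq; apply: eq_bigr => t tA.
  by rewrite inE tA; case: ifP => // _; rewrite normr0.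
have uC B : `|profile F e (restriction a B)| <= C by rewrite norm_profile -iotaN.
have [v vP] := weak_cluster_point Yrefl (@fset_directed_filter T) C0 uC.
have [b [bv _]] := e_basis v.
(* Coordinates of the profiles increase with the finite set, so those of the
   cluster point bound all of them. *)
have ab B j : profile_coord F (restriction a B) j <= b j.
  have [h hP] := basis_coordinate e_norm e_unc j.
  rewrite -(hP _ _ bv); apply: vP.
  apply: filterS (near_fset_directed B) => B' BB'.
  rewrite (hP _ _ (@expands_profile _ _ _ _ _ Fadm e_norm (restriction a B'))).
  rewrite ler_wpM2l ?exprn_ge0 // family_norm_mono // => t.
  rewrite !restrictionE; case: ifP => [tB|_]; last by rewrite normr0.
  by rewrite (fsubsetP BB' _ tB).
have eps2 : 0 < eps / 2 by rewrite divr_gt0.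
have [m mP] := expands_uniform_tail e_norm e_unc bv eps2.
have mS : 0 < m.+1%:R :> R by [].
have aK j A : F j A -> mass a A <= 2 ^+ j * C.
  move=> FA; rewrite -[A]fsetIid -massE.
  apply: le_trans (family_norm_ub _ FA) _.
  apply: le_trans (family_norm_le_space Fadm e_norm e_unc j _) _.
  by rewrite ler_wpM2l ?exprn_ge0 // -iotaN.
have [A0 A0P] := small_mass_off_finite Fadm aK Finc m (divr_gt0 eps2 mS).
(* Each of the [m] coordinates kept contributes at most [eps / 2 / m.+1]. *)
exists A0 => B dB; rewrite iotaN -norm_profile.
apply: le_trans (mP _ _ _ (@expands_profile _ _ _ _ _ Fadm e_norm _)) _.
  move=> j; have p0 := profile_coord_ge0 Fadm (restriction a B) j.
  by rewrite !ger0_norm //; exact: le_trans (ab B j).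
rewrite [leRHS]splitr lerD2r.
apply: (@le_trans _ _ (\sum_(0 <= j < m) (eps / 2 / m.+1%:R))).
  rewrite big_nat [leRHS]big_nat; apply: ler_sum => j /andP[_ jm].
  rewrite ger0_norm ?profile_coord_ge0 //.
  apply: (@le_trans _ _ (family_norm F m (restriction a B))).
    apply: le_trans (family_norm_incr Fadm _ (ltnW jm)).
    rewrite ler_piMl ?family_norm_ge0 // exprn_ile1 ?invr_ge0 // invf_le1 //.
    by rewrite ler1n.
  apply: family_norm_le => // A FA; rewrite massE; apply: A0P.
    by apply: (family_sub Fadm _ FA); exact: fsubsetIl.
  by apply: fdisjointWl dB; exact: fsubsetIr.
rewrite sumr_const_nat subn0 -[leLHS]mulr_natr -mulrA ger_pMr // mulrC ler_pdivrMr // mul1r.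
by rewrite ler_nat leqnSn.
Qed.

Hypothesis iota_dense : dense (range iota).

Lemma dual_norm_le_dense (h : dual X) (c : R) :
  (forall z, `|h (iota z)| <= c * `|iota z|) -> dual_norm h <= `|c|.
Proof.
move=> hc; apply: dual_norm_le => x x1; apply/ler_addgt0Pr => eps eps0.
pose M := dual_norm h + `|c|.
have M0 : 0 <= M by rewrite addr_ge0 // dual_norm_ge0.
have eta0 : 0 < eps / (M + 1) by rewrite divr_gt0 // ltr_wpDl.
have [y [xy [z _ yE]]] := iota_dense (ex_intro _ x (ballxx x eta0)) (ball_open x (eps / (M + 1))).
have xz : ball x (eps / (M + 1)) y by [].
move: xz; rewrite -{}yE -ball_normE /= => xz.
have hx : `|h (x - iota z)| <= dual_norm h * `|x - iota z| := dual_norm_apply h _.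
have hz : `|h (iota z)| <= `|c| * (1 + `|x - iota z|).
  apply: le_trans (hc z) _; apply: (@le_trans _ _ (`|c| * `|iota z|)).
    by rewrite ler_wpM2r // ler_norm.
  rewrite ler_wpM2l //.
  have := ler_normB x (x - iota z); rewrite subKr => h'.
  by apply: le_trans h' _; rewrite lerD2r.
have -> : h x = h (x - iota z) + h (iota z) by rewrite -linearD subrK.
apply: le_trans (ler_normD _ _) _; apply: (le_trans (lerD hx hz)).
rewrite mulrDr mulr1 addrCA lerD2l -mulrDl -/M.
apply: (@le_trans _ _ ((M + 1) * (eps / (M + 1)))).
  by apply: ler_pM => //; [rewrite lerDl|exact: ltW].
by rewrite mulrC divfK // gt_eqF // ltr_wpDl.
Qed.

Lemma coordinate_functional t :
  exists h : dual X, forall z, h (iota z) = z t.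
Proof.
have [|||z|h [_ hz]] := @dual_extension R X _ iota (fun z => z t) 1.
- by [].
- by [].
- exact: ler01.
- by rewrite mul1r iotaN; exact: coef_le_space.
- by exists h.
Qed.

(** An element [Phi] of the bidual is recovered from its values [a t] at the
    coordinate functionals [phi t]. The finite sections of [a] are bounded by the
    norm of [Phi], hence they converge to a vector [l] by bounded completeness.
    Each functional [f] is the norm limit of its finite restrictions [h f B], and
    [Phi (h f B)] is the value of [f] at the section of [a] over [B]; in the
    limit [Phi f = f l]. *)
Lemma completion_reflexive : reflexive_space X.
Proof.
move=> Phi; have /choice[phi phiE] := coordinate_functional.
pose a t := Phi (phi t).
pose h (f : dual X) (B : {fset T}) : dual X := \sum_(t <- B) f (iota (unit_vector R t)) *: phi t.
have hE f B z : h f B (iota z) = f (iota (restriction z B)).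
  rewrite restriction_sum !linear_sum /=.
  have -> : h f B (iota z) = \sum_(t <- B) f (iota (unit_vector R t)) * phi t (iota z).
    by rewrite /h; elim/big_rec2: _ => //= t u v _ <-.
  by apply: eq_bigr => t _; rewrite phiE !linearZ; exact: mulrC.
have PhiE f B : Phi (h f B) = f (iota (restriction a B)).
  rewrite restriction_sum !linear_sum /=.
  by apply: eq_bigr => t _; rewrite !linearZ; exact: mulrC.
have restr_le z B : `|iota (restriction z B)| <= `|iota z|.
  rewrite !iotaN; apply: space_norm_mono => // t.
  by rewrite restrictionE; case: ifP; rewrite ?normr0.
have sC B : `|iota (restriction a B)| <= dual_norm Phi.
  have [f [f1 <-]] := norming_functional (iota (restriction a B)).
  rewrite -PhiE; apply: le_trans (ler_norm _) _.
  apply: le_trans (dual_norm_apply _ _) _.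
  apply: ler_piMr; first exact: dual_norm_ge0.
  rewrite -(normr1 R); apply: dual_norm_le_dense => z; rewrite hE mul1r.
  exact: le_trans (f1 _) (restr_le z B).
have /cvg_ex[l sl] : cvg ((fun B : {fset T} => iota (restriction a B)) @ @fset_directed T).
  apply: cauchy_cvg; apply: cauchy_exP => eps eps0.
  have [|A AP] := norm_small_off_finite (a := a) (eps := eps / 2) sC; first by rewrite divr_gt0.
  exists (iota (restriction a A)); apply: filterS (near_fset_directed A) => B AB.
  rewrite -ball_normE /= distrC -linearB.
  have -> : restriction a B - restriction a A = restriction a (B `\` A)%fset.
    apply: c00P => t; rewrite c00D c00N !restrictionE inE.
    case: (boolP (t \in A)) => tA /=; first by rewrite (fsubsetP AB _ tA) subrr.
    by rewrite subr0.
  apply: le_lt_trans (AP _ _) _; last by rewrite ltr_pdivrMr // ltr_pMr ?ltr1n.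
  by apply/fdisjointP => t; rewrite inE => /andP[].
exists l; apply/val_inj/funext => f /=.
have fx : (fun B : {fset T} => f (iota (restriction a B)) : R^o) @ @fset_directed T --> f l.
  exact: (continuous_cvg _ (@dual_continuous _ _ f l) sl).
have fPhi : (fun B : {fset T} => f (iota (restriction a B)) : R^o) @ @fset_directed T --> (Phi f : R^o).
  apply/cvgrPdist_le => eps eps0.
  have M0 : 0 < dual_norm Phi + 1 by rewrite ltr_wpDl // dual_norm_ge0.
  have [A AP] := functional_small_off_finite f (divr_gt0 eps0 M0).
  apply: filterS (near_fset_directed A) => B AB; rewrite -PhiE -linearB.
  apply: le_trans (dual_norm_apply _ _) _.
  have d0 : 0 <= eps / (dual_norm Phi + 1) by rewrite ltW // divr_gt0.
  apply: (@le_trans _ _ ((dual_norm Phi + 1) * (eps / (dual_norm Phi + 1)))).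
    apply: ler_pM; [exact: dual_norm_ge0|exact: dual_norm_ge0|by rewrite lerDl|].
    rewrite -(ger0_norm d0); apply: dual_norm_le_dense => z.
    have -> : (f - h f B) (iota z) = f (iota (z - restriction z B)).
      have -> : (f - h f B) (iota z) = f (iota z) - h f B (iota z) by [].
      by rewrite hE -!linearB.
    apply: le_trans (AP _ _) _.
      apply/fdisjointP => t; rewrite mem_supp c00D c00N restrictionE.
      by apply: contraNN => tA; rewrite (fsubsetP AB _ tA) subrr.
    apply: ler_wpM2l => //; rewrite !iotaN; apply: space_norm_mono => // t.
    by rewrite c00D c00N restrictionE; case: ifP; rewrite ?subrr ?subr0 ?normr0.
  by rewrite mulrC divfK // gt_eqF.
exact: (cvg_unique _ fx fPhi).
Qed.

End Completion.

Theorem theorem4p4 (R : realType) (S : finType)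
    (F : nat -> set {fset (nat -> S)})
    (Y : completeNormedModType R) (e : nat -> Y)
    (X : completeNormedModType R) (iota : {linear c00 R (nat -> S) -> X}) :
  (2 <= #|S|)%N ->
  admissible_families F ->
  reflexive_space Y ->
  schauder_basis e -> normalized_seq e -> unconditional1 e ->
  is_completion (space_norm F e) iota ->
  inclusion_condition F ->
  reflexive_space X.
Proof.
move=> _ Fadm Yrefl e_basis e_norm e_unc [iotaN iota_dense] Finc.
exact: (completion_reflexive Fadm Yrefl e_basis e_norm e_unc iotaN Finc iota_dense).
Qed.
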